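(* Let $g$ be a computable function such that both $g(n)$ and $n-g(n)$ are unbounded, and let $c$ be a nonnegative constant. Then for every positive integer $k$: (i) the set $\mathrm{HIGH}_g=\{x: C(x)\ge g(|x|)\}$ is not $(1,k)$-recursive, and (ii) the set $\mathrm{HIGH}_{n-c}=\{x: C(x)\ge |x|-c\}$ is not $(1,k)$-recursive.
   Context: Here $x$ ranges over binary strings, $|x|$ is the length of $x$, and $C(x)$ is the plain Kolmogorov complexity of $x$ with respect to a fixed universal machine. A set $A$ is $(1,k)$-recursive if there is a computable function $f$ mapping $k$-tuples to label vectors in $\{0,1\}^k$ such that for every tuple $(x_1,\dots,x_k)$ the vectors $(\chi_A(x_1),\dots,\chi_A(x_k))$ and $f(x_1,\dots,x_k)$ agree in at least one position.
   Formalization: The hypothesis is taken as: g(n) and n-g(n) are each unbounded over the lengths n with g(n) ≤ n; without this restriction (i) fails, e.g. for g(n)=0 (n even), g(n)=2n (n odd), where HIGH_g is computable. *)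

(* Defs.v *)
From mathcomp Require Import all_boot.
From mathcomp Require Import boolp.

Set Implicit Arguments.
Unset Strict Implicit.
Unset Printing Implicit Defensive.

(* Kleene's partial recursive functions: [recfun n] is the type of definitions
   of partial functions from nat^n to nat. *)
Inductive recfun : nat -> Type :=
  | Zero : recfun 0
  | Succ : recfun 1
  | Proj n : 'I_n -> recfun n
  | Comp k n : recfun k -> ('I_k -> recfun n) -> recfun n
  | Prec n : recfun n -> recfun n.+2 -> recfun n.+1
  | Mu n : recfun n.+1 -> recfun n.

(* [eval e v y] means that the partial function defined by [e] is defined at
   [v] with value [y]. [Prec e1 e2] recurses on the first argument, [e2] being
   applied to the recursion index, the previous value and the parameters; the
   function [s] below lists the successive values. *)
Fixpoint eval n (e : recfun n) : n.-tuple nat -> nat -> Prop :=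
  match e in recfun n return n.-tuple nat -> nat -> Prop with
  | Zero => fun _ y => y = 0
  | Succ => fun v y => y = (thead v).+1
  | Proj _ i => fun v y => y = tnth v i
  | Comp k _ e0 es => fun v y => exists w : k.-tuple nat,
      (forall i, eval (es i) v (tnth w i)) /\ eval e0 w y
  | Prec n e1 e2 => fun v y => exists s : nat -> nat,
      [/\ eval e1 (behead_tuple v) (s 0),
          forall i, i < thead v ->
            eval e2 (cons_tuple i (cons_tuple (s i) (behead_tuple v))) (s i.+1)
        & y = s (thead v)]
  | Mu n e1 => fun v y => eval e1 (cons_tuple y v) 0 /\
      forall i, i < y -> exists z, eval e1 (cons_tuple i v) z.+1
  end.

Definition computable (g : nat -> nat) : Prop :=
  exists e : recfun 1, forall n, eval e [tuple n] (g n).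

Notation string := (seq bool).

(* Strings are identified with numbers through bijective base-2 notation, least
   significant digit first, with digits 1 and 2 for [false] and [true]. *)
Fixpoint code (x : string) : nat :=
  if x is b :: x' then (code x').*2 + b.+1 else 0.

Lemma code_inj : injective code.
Proof.
elim=> [|a x IHx] [|b y] //=; rewrite ?addnS // => /succn_inj.
by case: a b => [] []; rewrite ?addn1 ?addn0 => E; congr (_ :: _);
  move: (congr1 odd E) (congr1 half E);
  rewrite /= ?odd_double ?uphalf_double ?doubleK // => _ /IHx.
Qed.

Lemma code_surj (m : nat) : exists x, code x = m.
Proof.
elim/ltn_ind: m => [[|m]] IHm; first by exists [::].
have [|x Ex] := IHm m./2; first by rewrite ltnS -divn2 leq_div.
by exists (odd m :: x); rewrite /= Ex addnS addnC odd_double_half.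
Qed.

Definition outputs (M : recfun 1) (p x : string) : Prop :=
  eval M [tuple code p] (code x).

(* Universality is additive optimality; machines [U] such that every machine
   [M] has a prefix [w] with [U (w ++ p) = M p] for all [p] satisfy it. *)
Definition universal (U : recfun 1) : Prop :=
  forall M : recfun 1, exists d : nat, forall p x, outputs M p x ->
    exists2 q, outputs U q x & size q <= size p + d.

Record universal_machine := UniversalMachine {
  machine :> recfun 1;
  machine_universal : universal machine }.

Lemma has_program_size (U : universal_machine) (x : string) :
  exists n, `[< exists2 p, outputs U p x & size p = n >].
Proof.
have [d Hd] := machine_universal U (Proj ord0).
have [|q Uqx _] := Hd x x; first by [].
by exists (size q); apply/asboolP; exists q.
Qed.

Definition C (U : universal_machine) (x : string) : nat :=
  ex_minn (has_program_size U x).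

Definition HIGH (U : universal_machine) (g : nat -> nat) : {pred string} :=
  fun x => g (size x) <= C U x.

Definition computable_labelling k (f : k.-tuple string -> k.-tuple bool) :=
  exists e : 'I_k -> recfun k, forall xs i,
    eval (e i) (map_tuple code xs) (tnth (f xs) i : nat).

Definition one_k_recursive k (A : {pred string}) : Prop :=
  exists2 f : k.-tuple string -> k.-tuple bool, computable_labelling f &
    forall xs, exists i, (tnth xs i \in A) = tnth (f xs) i.

(* Main.v *)
Require Import Defs.
From mathcomp Require Import all_boot.
From mathcomp Require Import boolp zify.

Set Implicit Arguments.
Unset Strict Implicit.
Unset Printing Implicit Defensive.

(* Let [n] be a length with [G = g n <= n]. Among the first [2 ^ G] strings of
   length [n], a fraction bounded below by a constant belongs to HIGH. If [f]
   witnesses (1,k)-recursiveness, negating it excludes one pattern for each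
   k-tuple, so by Sauer-Shelah only polynomially many subsets of these [2 ^ G]
   strings are consistent with [f], and a greedy choice gives a set of [O(G)]
   strings meeting every dense consistent subset, in particular HIGH. Such a
   set can be computed from [n], by exhaustive search, and [n] from any [m],
   as the least [n] with [m <= g n <= n]. Hence some string in HIGH has
   complexity [O(log G)], which is less than [G] for [m] large. Nothing is
   required of [n - g n], so (ii) is the case [g n = n - c]. *)

(** * Total recursive functions *)

(** Evaluation is deterministic; [many_high] uses this to see that strings with a common program
    coincide. *)
Lemma eval_functional n (e : recfun n) v y y' :
  eval e v y -> eval e v y' -> y = y'.
Proof.
elim: e v y y' => /=
  [v y y' -> -> //|v y y' -> -> //|{}n i v y y' -> -> //||{}n e1 IH1 e2 IH2|{}n e IH].
- move=> k {}n e0 IH0 es IHs v y y' [w [Hw Hy]] [w' [Hw' Hy']].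
  apply: (IH0 w) => //; suff -> : w = w' by [].
  by apply: eq_from_tnth => i; apply: IHs (Hw i) (Hw' i).
- move=> v y y' [s [s0 sS ->]] [s' [s0' sS' ->]].
  suff H i : i <= thead v -> s i = s' i by exact: H.
  elim: i => [_|i IHi lt_i]; first exact: IH1 s0 s0'.
  by have := sS i lt_i; rewrite (IHi (ltnW lt_i)) => /IH2; apply; apply: sS'.
- move=> v y y' [Hy ly] [Hy' ly']; case: (ltngtP y y') => // lt.
  + by have [z /(IH _ _ _ Hy)] := ly' _ lt.
  + by have [z /(IH _ _ _ Hy')] := ly _ lt.
Qed.

(* Only the values of [F] on lists of length [n] matter. *)
Definition recursive n (F : seq nat -> nat) :=
  exists e : recfun n, forall v : n.-tuple nat, eval e v (F v).

Lemma recursive_ext n (F G : seq nat -> nat) :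
  (forall v : n.-tuple nat, F v = G v) -> recursive n F -> recursive n G.
Proof. by move=> FG [e He]; exists e => v; rewrite -FG. Qed.

Lemma recursive_nth n i : i < n -> recursive n (fun s => nth 0 s i).
Proof.
by move=> lt_i; exists (Proj (Ordinal lt_i)) => v; rewrite /= (tnth_nth 0).
Qed.

Lemma recursive_head n : recursive n.+1 (head 0).
Proof. by apply: recursive_ext (recursive_nth (ltn0Sn n)) => v; rewrite nth0. Qed.

Lemma recursive_comp k n F (a : 'I_k -> seq nat -> nat) :
  recursive k F -> (forall i, recursive n (a i)) ->
  recursive n (fun s => F [seq a i s | i <- enum 'I_k]).
Proof.
move=> [e He] /choice[es Hes]; exists (Comp e es) => v /=.
exists [tuple a i v | i < k]; split=> [i|]; first by rewrite tnth_mktuple.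
exact: (He [tuple a i v | i < k]).
Qed.

Lemma recursive_subst n F a : recursive n.+1 F -> recursive n a ->
  recursive n (fun s => F (a s :: s)).
Proof.
move=> RF Ra.
apply: (@recursive_ext _ (fun s => F [seq nth 0 (a s :: s) i |
  i : 'I_n.+1 <- enum 'I_n.+1])).
  move=> v; congr F; apply: (@eq_from_nth _ 0).
    by rewrite size_map size_enum_ord /= size_tuple.
  move=> i; rewrite size_map size_enum_ord => lt_i.
  by rewrite (nth_map (Ordinal lt_i)) ?size_enum_ord // nth_enum_ord.
apply: recursive_comp RF _ => -[[|i] lt_i] //=; exact: recursive_nth.
Qed.

Lemma recursive_behead n F : recursive n F ->
  recursive n.+1 (fun s => F (behead s)).
Proof.
move=> RF.
apply: (@recursive_ext _ (fun s => F [seq nth 0 s i.+1 | i : 'I_n <- enum 'I_n])).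
  move=> v; congr F; apply: (@eq_from_nth _ 0).
    by rewrite size_map size_enum_ord size_behead size_tuple.
  move=> i; rewrite size_map size_enum_ord => lt_i.
  by rewrite (nth_map (Ordinal lt_i)) ?size_enum_ord // nth_enum_ord // nth_behead.
by apply: (recursive_comp (a := fun (i : 'I_n) s => nth 0 s i.+1) RF) => i;
  apply: recursive_nth; rewrite ltnS.
Qed.

Lemma recursive_behead2 n F : recursive n F ->
  recursive n.+2 (fun s => F (behead (behead s))).
Proof.
move=> RF; apply: (recursive_behead (F := fun s => F (behead s))).
exact: recursive_behead.
Qed.

Lemma recursive_call1 n (f : nat -> nat) a :
  recursive 1 (fun s => f (head 0 s)) -> recursive n a ->
    recursive n (fun s => f (a s)).
Proof.
move=> Rf Ra.
apply: (@recursive_ext _ (fun s => f (head 0 [seq a s | i : 'I_1 <- enum 'I_1]))).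
  by move=> v; rewrite enum_ordSl.
by apply: recursive_comp Rf _.
Qed.

Lemma recursive_succ n a : recursive n a -> recursive n (fun s => (a s).+1).
Proof.
apply: (recursive_call1 (f := succn)).
by exists Succ => v /=; rewrite [v in LHS]tuple_eta.
Qed.

Lemma recursive_const n c : recursive n (fun=> c).
Proof.
elim: c => [|c]; last exact: recursive_succ.
(* [Zero] has arity 0; composing it with the empty family raises it to arity [n]. *)
pose a (i : 'I_0) (s : seq nat) := 0.
apply: (@recursive_ext _ (fun s => (fun=> 0) [seq a i s | i <- enum 'I_0])) => //.
by apply: (@recursive_comp 0 n (fun=> 0) a) => [|[]//]; exists Zero.
Qed.

(** [Prec] recurses on its first argument, so the bound is made an extra leading argument, for which
    [recursive_subst] then puts [a s]. *)
Lemma recursive_nat_rec n a b (st : nat -> nat -> seq nat -> nat) :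
  recursive n a -> recursive n b ->
  recursive n.+2 (fun s => st (head 0 s) (head 0 (behead s)) (behead (behead s))) ->
  recursive n (fun s => nat_rec (fun=> nat) (b s) (fun i y => st i y s) (a s)).
Proof.
move=> Ra [eb Hb] [est Hst].
pose F s := nat_rec (fun=> nat) (b (behead s)) (fun i y => st i y (behead s))
  (head 0 s).
apply: (recursive_subst (F := F)) => //.
exists (Prec eb est) => v /=.
exists (fun m => nat_rec (fun=> nat) (b (behead v))
  (fun i y => st i y (behead v)) m).
split=> [|i _|]; first exact: (Hb (behead_tuple v)).
  set y := nat_rec _ _ _ i; exact: (Hst (cons_tuple i (cons_tuple y
    (behead_tuple v)))).
by rewrite /F; case/tupleP: v.
Qed.

(** [Mu] searches for a zero, hence the negation of [P]; [exP] makes the search total. *)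
Lemma recursive_mu n (P : nat -> seq nat -> bool)
    (exP : forall s, exists y, P y s) :
  recursive n.+1 (fun s => ~~ P (head 0 s) (behead s)) ->
  recursive n (fun s => ex_minn (exP s)).
Proof.
move=> [e He]; exists (Mu e) => v /=; case: ex_minnP => y Py min_y; split.
  by have := He (cons_tuple y v); rewrite /= Py.
move=> i lt_i; exists 0; have := He (cons_tuple i v).
by rewrite /=; case: (boolP (P i v)) => // /min_y; rewrite leqNgt lt_i.
Qed.

(** * Sauer-Shelah and greedy hitting sets *)

(** Here [h I] is the pattern forbidden on the subsequence [I]. Deleting first coordinates turns [F]
    into [P], and [D] collects the vectors of [P] with both extensions in [F]. On the tail, [P]
    avoids patterns of the same length, [D] patterns shorter by one, and the two bounds add up. *)
Lemma sauer_shelah (T : Type) (k : nat) (h : seq T -> seq bool)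
    (L : seq T) (F : seq (seq bool)) :
  uniq F -> (forall w, w \in F -> size w = size L) ->
  (forall I, size (h I) = size I) ->
  (forall w m, w \in F -> size m = size L -> size (mask m L) = k ->
     mask m w <> h (mask m L)) ->
  size F <= (size L).+1 ^ k.
Proof.
elim: L k h F => [|x L IHL] k h F uF sF sh Fh.
  have sub : {subset F <= [:: [::]]} by move=> w /sF /size0nil ->.
  by rewrite exp1n; apply: uniq_leq_size uF sub.
case: k Fh => [|k] Fh.
  (* For [k = 0] the forbidden pattern is [[::]] on the empty subsequence; every vector shows it, so
     [F] is empty. *)
  case: F {uF} sF Fh => // w F sF Fh.
  have := Fh w (nseq (size L).+1 false) (mem_head _ _).
  rewrite size_nseq !mask_false => /(_ erefl erefl); case.
  by apply/esym/size0nil; rewrite sh.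
pose P := undup [seq behead w | w <- F].
pose D := [seq w <- P | (true :: w \in F) && (false :: w \in F)].
have FP w : w \in P -> exists2 b, b :: w \in F & size w = size L.
  rewrite mem_undup => /mapP[[|b w0] w0F ->]; have := sF _ w0F => //= -[sw].
  by exists b.
have lePD : size F <= size P + size D.
  pose S b := [seq b :: w | w <- P & b :: w \in F].
  have -> : size P + size D = size (S true ++ S false).
    rewrite size_cat !size_map !size_filter -count_predUI; congr (_ + _).
    apply/esym/eqP; rewrite -all_count; apply/allP => w.
    by case/FP => -[] Fw _ /=; rewrite Fw ?orbT.
  apply: uniq_leq_size => // w Fw; rewrite mem_cat.
  have := sF _ Fw; case: w Fw => // b w Fw _.
  have wP : w \in P by rewrite mem_undup; apply/mapP; exists (b :: w).
  have : b :: w \in S b by apply/mapP; exists w; rewrite // mem_filter Fw.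
  by case: b {Fw} => ->; rewrite ?orbT.
have leP : size P <= (size L).+1 ^ k.+1.
  apply: (IHL k.+1 h) => //; first exact: undup_uniq.
    by move=> w /FP[].
  move=> w m /FP[b Fw _] sm; exact: (Fh (b :: w) (false :: m) Fw (congr1 S sm)).
have leD : size D <= (size L).+1 ^ k.
  (* The first bit of the pattern on [x :: I] may be dropped, since a vector in [D] extends by
     either bit. *)
  apply: (IHL k (fun I => behead (h (x :: I)))) => //.
  - by apply: filter_uniq; apply: undup_uniq.
  - by move=> w; rewrite mem_filter => /andP[_ /FP[]].
  - by move=> I; rewrite size_behead sh.
  move=> w m; rewrite mem_filter => /andP[/andP[Ft Ff] _] sm sk Eh.
  pose b := head true (h (x :: mask m L)).
  have Fb : b :: w \in F by case: b.
  apply: (Fh (b :: w) (true :: m) Fb (congr1 S sm)); first by rewrite /= sk.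
  rewrite /= Eh /b; have := sh (x :: mask m L).
  by case: (h _).
apply: leq_trans lePD _; apply: leq_trans (leq_add leP leD) _.
rewrite expnS -mulSnr /= expnS leq_mul //.
by case: k {Fh leP leD} => // k; rewrite leq_exp2r.
Qed.

Lemma sum_const_seq (T : Type) (s : seq T) c : \sum_(x <- s) c = size s * c.
Proof. by rewrite big_const_seq count_predT iter_addn_0 mulnC. Qed.

(** By averaging, some point lies in at least a fraction [1 / (e + 1)] of the sets; choosing it
    leaves at most [e / (e + 1)] of them unhit. After [t] rounds fewer than one is left. *)
Lemma greedy_hitting (T U : eqType) (r : U -> T -> bool)
    (L : seq T) (e t : nat) (F : seq U) :
  0 < size L -> (forall h, h \in F -> size L <= e.+1 * count (r h) L) ->
  size F * e ^ t < e.+1 ^ t ->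
  exists S : seq T, [/\ size S = t, {subset S <= L} &
    forall h, h \in F -> has (r h) S].
Proof.
move=> L0; elim: t F => [|t IHt] F dF.
  by rewrite !expn0 muln1 ltnS leqn0 size_eq0 => /eqP->; exists [::].
move=> ltF.
have [x Lx Fx] : exists2 x, x \in L & size F <= e.+1 * count (r^~ x) F.
  (* If no point qualifies, counting incidences by points and by sets gives two bounds that are
     incompatible by a margin of [size L]. *)
  apply/hasP; apply: contraT; rewrite -all_predC => /allP /= noL.
  have E : \sum_(x <- L) count (r^~ x) F = \sum_(h <- F) count (r h) L.
    under eq_bigr => x _ do rewrite -sum1_count big_mkcond /=.
    rewrite exchange_big /=; apply: eq_bigr => h _.
    by rewrite -big_mkcond sum1_count.
  have [F0|F0] := posnP (size F).
    case: L L0 noL {IHt dF E} => // x L _ /(_ x (mem_head _ _)).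
    by rewrite F0.
  have le1 : \sum_(x <- L) (e.+1 * count (r^~ x) F).+1 <= \sum_(x <- L) size F.
    rewrite !big_seq; apply: leq_sum => x Lx.
    by have := noL x Lx; rewrite -ltnNge.
  have le2 : \sum_(h <- F) size L <= \sum_(h <- F) e.+1 * count (r h) L.
    by rewrite !big_seq; apply: leq_sum => h; apply: dF.
  move: le1 le2; under eq_bigr => x _ do rewrite -addn1.
  rewrite big_split /= sum1_size -!big_distrr /= E !sum_const_seq.
  rewrite [size F * _]mulnC => le1 le2; move: (leq_trans le1 le2).
  by rewrite -[X in _ <= X]addn0 leq_add2l leqNgt L0.
have [h /[!mem_filter] /andP[_]||S [sS SL SF]] := IHt [seq h <- F | ~~ r h x].
- exact: dF.
- rewrite -(ltn_pmul2r (ltn0Sn e)) -expnSr.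
  apply: leq_ltn_trans ltF; rewrite mulnAC expnS mulnA leq_mul //.
  rewrite size_filter; have := count_predC (r^~ x) F; move: Fx.
  rewrite -[count (predC _) F]/(count (fun h => ~~ r h x) F).
  set u := count _ F; set v := count _ F => Fx Euv.
  rewrite -Euv in Fx *; nia.
exists (x :: S); split=> /= [|y|h Fh]; first by rewrite sS.
  by rewrite inE => /predU1P[->//|/SL].
by case: (boolP (r h x)) => //= rhx; apply: SF; rewrite mem_filter rhx.
Qed.

(** * Numbers as sequences of digits *)

Definition digit b t i := (t %/ b ^ i) %% b.

Lemma digit_lt b t i : 0 < b -> digit b t i < b.
Proof. exact: ltn_pmod. Qed.

Lemma ex_digits b l (a : nat -> nat) : (forall i, i < l -> a i < b) ->
  exists2 t, t < b ^ l & forall i, i < l -> digit b t i = a i.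
Proof.
elim: l a => [|l IHl] a ab; first by exists 0.
have [i lt_i|t lt_t dt] := IHl (fun i => a i.+1); first exact: ab.
have a0 := ab 0 isT; have b0 : 0 < b by apply: leq_ltn_trans a0.
exists (t * b + a 0) => [|[_|i lt_i]].
- rewrite expnSr; apply: (@leq_trans (t.+1 * b)).
    by rewrite mulSnr ltn_add2l.
  by rewrite leq_mul2r lt_t orbT.
- by rewrite /digit divn1 modnMDl modn_small.
by rewrite /digit expnS divnMA divnMDl // (divn_small a0) addn0 -dt.
Qed.

Lemma digits_inj b l t t' : t < b ^ l -> t' < b ^ l ->
  (forall i, i < l -> digit b t i = digit b t' i) -> t = t'.
Proof.
elim: l t t' => [|l IHl] t t'; first by rewrite !ltnS !leqn0 => /eqP-> /eqP->.
case: (posnP b) => [->|b0]; first by rewrite exp0n.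
rewrite expnSr -!ltn_divLR // => lt_t lt_t' dtt'.
have Em := dtt' 0 isT; rewrite /digit !divn1 in Em.
rewrite (divn_eq t b) (divn_eq t' b) Em; congr (_ * _ + _).
apply: IHl => // i lt_i; rewrite /digit -!divnMA -expnS; exact: (dtt' i.+1).
Qed.

Lemma cube_le_exp2 G : G.+1 ^ 3 <= 8 * 2 ^ G.
Proof.
(* The inductive step needs [(G + 2) ^ 3 <= 2 * (G + 1) ^ 3], true only from [G = 3] on. *)
elim: G => // G IHG; have [|G3] := ltnP G 3; first by case: G {IHG} => [|[|[|]]].
rewrite [2 ^ _]expnS mulnCA; apply: leq_trans (leq_mul (leqnn 2) IHG).
rewrite !expnS expn0 !muln1; nia.
Qed.

(** The first two binomial terms of [(e + 1) ^ e.+1] already give [2 * e ^ e.+1]; the claim is the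
    [t]-th power of this. *)
Lemma halving e t : 2 ^ t * e ^ (e.+1 * t) <= e.+1 ^ (e.+1 * t).
Proof.
rewrite !expnM -expnMn; case: t => // t; rewrite leq_exp2r //.
case: e => // e.
rewrite -[X in _ <= X ^ _]addn1 expnDn big_ord_recl big_ord_recl /= addnA.
rewrite /bump /= !subn0 bin0 !exp1n !muln1 mul1n bin1 subn1 /=.
apply: leq_trans (leq_addr _ _).
rewrite mul2n -addnn leq_add2l expnS leq_mul //.
Qed.

(** * Recursive arithmetic *)

Lemma recursive_pred n a : recursive n a -> recursive n (fun s => (a s).-1).
Proof.
apply: (recursive_call1 (f := predn)).
apply: (@recursive_ext _ (fun s => nat_rec (fun=> nat) 0 (fun i _ => i)
  (head 0 s))).
  by move=> v; case: head.
by apply: (@recursive_nat_rec 1 (head 0) (fun=> 0) (fun i _ _ => i));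
  [exact: recursive_head|exact: recursive_const|exact: recursive_head].
Qed.

Lemma recursive_iter n f a b :
  recursive 1 (fun s => f (head 0 s)) -> recursive n a -> recursive n b ->
  recursive n (fun s => iter (a s) f (b s)).
Proof.
move=> Rf Ra Rb.
apply: (@recursive_ext _ (fun s => nat_rec (fun=> nat) (b s) (fun _ y => f y)
  (a s))).
  by move=> v; elim: (a v) => //= m ->.
apply: (recursive_nat_rec (st := fun _ y _ => f y)) => //.
exact: recursive_call1 Rf (recursive_behead (recursive_head n)).
Qed.

Lemma recursive_add n a b : recursive n a -> recursive n b ->
  recursive n (fun s => a s + b s).
Proof.
move=> Ra Rb.
apply: (@recursive_ext _ (fun s => iter (a s) succn (b s))) => [v|].
  by rewrite iter_succn addnC.
by apply: recursive_iter => //; apply/recursive_succ/recursive_head.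
Qed.

Lemma recursive_sub n a b : recursive n a -> recursive n b ->
  recursive n (fun s => a s - b s).
Proof.
move=> Ra Rb.
apply: (@recursive_ext _ (fun s => iter (b s) predn (a s))) => [v|].
  by rewrite iter_predn.
by apply: recursive_iter => //; apply/recursive_pred/recursive_head.
Qed.

Lemma recursive_mul n a b : recursive n a -> recursive n b ->
  recursive n (fun s => a s * b s).
Proof.
move=> Ra Rb.
apply: (@recursive_ext _ (fun s => nat_rec (fun=> nat) 0 (fun _ y => b s + y)
  (a s))).
  by move=> v; elim: (a v) => //= m ->; rewrite mulSn.
apply: (recursive_nat_rec (st := fun _ y s => b s + y)) => //;
  first exact: recursive_const.
by apply: recursive_add; [exact: recursive_behead2 |
  exact: recursive_behead (recursive_head n)].
Qed.

Lemma recursive_exp n a b : recursive n a -> recursive n b ->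
  recursive n (fun s => a s ^ b s).
Proof.
move=> Ra Rb.
apply: (@recursive_ext _ (fun s => nat_rec (fun=> nat) 1 (fun _ y => a s * y)
  (b s))).
  by move=> v; elim: (b v) => //= m ->; rewrite expnS.
apply: (recursive_nat_rec (st := fun _ y s => a s * y)) => //;
  first exact: recursive_const.
by apply: recursive_mul; [exact: recursive_behead2 |
  exact: recursive_behead (recursive_head n)].
Qed.

Lemma recursive_sum n a (F : nat -> seq nat -> nat) :
  recursive n a -> recursive n.+1 (fun s => F (head 0 s) (behead s)) ->
  recursive n (fun s => \sum_(i < a s) F i s).
Proof.
move=> Ra RF.
apply: (@recursive_ext _ (fun s => nat_rec (fun=> nat) 0
  (fun i y => y + F i s) (a s))).
  by move=> v; elim: (a v) => [|m IHm] /=; rewrite ?big_ord0 // big_ord_recr IHm.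
apply: (recursive_nat_rec (st := fun i y s => y + F i s)) => //;
  first exact: recursive_const.
apply: recursive_add; first exact: recursive_behead (recursive_head n).
(* The recursion step receives the index, the partial sum and the parameters; [a2] skips the partial
   sum. *)
pose a2 (i : 'I_n.+1) s := if i == 0 :> nat then head 0 s else nth 0 s i.+1.
apply: (@recursive_ext _ (fun s => (fun s' => F (head 0 s') (behead s'))
   [seq a2 i s | i <- enum 'I_n.+1])) => [v|].
  rewrite enum_ordSl /=; congr F; apply: (@eq_from_nth _ 0).
    by rewrite -map_comp size_map size_enum_ord !size_behead size_tuple.
  move=> i; rewrite -map_comp size_map size_enum_ord => lt_i.
  by rewrite (nth_map (Ordinal lt_i)) ?size_enum_ord //= /a2 /= /bump /=
    nth_enum_ord // !nth_behead.
apply: (@recursive_comp _ _ (fun s => F (head 0 s) (behead s)) a2 RF)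
  => -[[|i] lt_i].
  exact: recursive_head.
by apply: recursive_nth; rewrite ltnS.
Qed.

Lemma recursive_neg n (P : seq nat -> bool) : recursive n P ->
  recursive n (fun s => ~~ P s).
Proof.
move=> RP; apply: (@recursive_ext _ (fun s => 1 - P s)) => [v|];
  first by case: (P v).
by apply: recursive_sub => //; apply: recursive_const.
Qed.

Lemma recursive_and n (P Q : seq nat -> bool) : recursive n P ->
  recursive n Q -> recursive n (fun s => P s && Q s).
Proof.
move=> RP RQ; apply: (@recursive_ext _ (fun s => P s * Q s)) => [v|];
  first by case: (P v); case: (Q v).
exact: recursive_mul.
Qed.

Lemma recursive_or n (P Q : seq nat -> bool) : recursive n P ->
  recursive n Q -> recursive n (fun s => P s || Q s).
Proof.
move=> RP RQ; apply: (@recursive_ext _ (fun s => ~~ (~~ P s && ~~ Q s))) => [v|].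
  by rewrite negb_and !negbK.
by apply/recursive_neg/recursive_and; apply: recursive_neg.
Qed.

Lemma recursive_eq0 n a : recursive n a -> recursive n (fun s => a s == 0).
Proof.
move=> Ra; apply: (@recursive_ext _ (fun s => 1 - a s)) => [v|];
  first by case: (a v) => [|[]].
by apply: recursive_sub => //; apply: recursive_const.
Qed.

Lemma recursive_leq n a b : recursive n a -> recursive n b ->
  recursive n (fun s => a s <= b s).
Proof. by move=> Ra Rb; apply/recursive_eq0/recursive_sub. Qed.

Lemma recursive_eq n a b : recursive n a -> recursive n b ->
  recursive n (fun s => a s == b s).
Proof.
move=> Ra Rb; apply: (@recursive_ext _ (fun s => (a s <= b s) &&
  (b s <= a s))) => [v|].
  by rewrite eqn_leq.
by apply: recursive_and; apply: recursive_leq.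
Qed.

Lemma recursive_forall n a (P : nat -> seq nat -> bool) :
  recursive n a -> recursive n.+1 (fun s => P (head 0 s) (behead s)) ->
  recursive n (fun s => all (P^~ s) (iota 0 (a s))).
Proof.
move=> Ra RP.
apply: (@recursive_ext _ (fun s => \sum_(i < a s) ~~ P i s == 0)) => [v|].
  rewrite sum_nat_eq0; congr nat_of_bool; apply/forallP/allP => [H i|H i].
    by rewrite mem_iota add0n => /= lt_i; move: (H (Ordinal lt_i));
      rewrite eqb0 negbK.
  by rewrite eqb0 negbK H // mem_iota add0n /=.
by apply/recursive_eq0/(recursive_sum (F := fun i s => ~~ P i s)) => //;
  apply: recursive_neg.
Qed.

Lemma recursive_exists n a (P : nat -> seq nat -> bool) :
  recursive n a -> recursive n.+1 (fun s => P (head 0 s) (behead s)) ->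
  recursive n (fun s => has (P^~ s) (iota 0 (a s))).
Proof.
move=> Ra RP.
apply: (@recursive_ext _ (fun s => ~~ all (fun i => ~~ P i s)
  (iota 0 (a s)))) => [v|].
  by rewrite -has_predC; congr nat_of_bool; apply: eq_has => i /=; rewrite negbK.
by apply/recursive_neg/(recursive_forall (P := fun i s => ~~ P i s)) => //;
  apply: recursive_neg.
Qed.

Lemma recursive_has n (I : Type) (P : I -> seq nat -> bool) (r : seq I) :
  (forall i, recursive n (P i)) -> recursive n (fun s => has (P^~ s) r).
Proof.
by move=> RP; elim: r => [|i r IHr]; [exact: recursive_const | exact: recursive_or].
Qed.

(** The quotient counts the positive multiples of the divisor up to the dividend; the guard gives 0
    for divisor 0. *)
Lemma recursive_divn n a b : recursive n a -> recursive n b ->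
  recursive n (fun s => a s %/ b s).
Proof.
move=> Ra Rb.
apply: (@recursive_ext _ (fun s => \sum_(i < a s) ((1 <= b s) &&
  (i.+1 * b s <= a s)))) => [v|].
  move: (a v) (b v) => p q; case: (posnP q) => [->|q0]; first by rewrite divn0 big1.
  under eq_bigr => i _ do rewrite -leq_divRL //.
  have : p %/ q <= p by exact: leq_div.
  suff : forall p r, \sum_(i < p) (i < r) = minn p r by move=> -> /minn_idPr.
  by move=> {}p r; elim: p => [|p IHp];
    rewrite ?big_ord0 ?big_ord_recr /= ?IHp; lia.
apply: (recursive_sum (F := fun i s => (1 <= b s) && (i.+1 * b s <= a s))) => //.
have Rb' := recursive_behead Rb.
apply: recursive_and; apply: recursive_leq => //; first exact: recursive_const.
  by apply: recursive_mul => //; apply/recursive_succ/recursive_head.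
exact: recursive_behead.
Qed.

Lemma recursive_modn n a b : recursive n a -> recursive n b ->
  recursive n (fun s => a s %% b s).
Proof.
move=> Ra Rb; apply: (@recursive_ext _ (fun s => a s - a s %/ b s * b s)) => [v|].
  by rewrite {1}(divn_eq (a v) (b v)) addKn.
by apply: recursive_sub => //; apply: recursive_mul => //; apply: recursive_divn.
Qed.

Lemma recursive_digit n a b c : recursive n a -> recursive n b -> recursive n c ->
  recursive n (fun s => digit (a s) (b s) (c s)).
Proof.
by move=> Ra Rb Rc; apply: recursive_modn => //; apply: recursive_divn => //;
  apply: recursive_exp.
Qed.

(** * Counting strings of high complexity *)

(** A new digit [b] turns [m = code x + 1] into [2 * m + b], so each digit adds one to the binary
    length of [m]. Hence codes list the strings by length. *)
Lemma code_size_bounds x : 2 ^ size x <= (code x).+1 < 2 ^ (size x).+1.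
Proof.
elim: x => //= b x /andP[lb ub]; rewrite !expnS in ub *.
by case: b; apply/andP; split; lia.
Qed.

Definition decode (m : nat) : string := projT1 (cid (code_surj m)).

Lemma decodeK m : code (decode m) = m.
Proof. by rewrite /decode; case: cid. Qed.

Lemma decode_inj : injective decode.
Proof. by move=> m m' E; rewrite -(decodeK m) E decodeK. Qed.

(* [decode (point n i)], for [i < 2 ^ n], are the strings of length [n]. *)
Definition point n i := (2 ^ n).-1 + i.

Lemma size_point n i : i < 2 ^ n -> size (decode (point n i)) = n.
Proof.
move=> lt_i; have /andP[] := code_size_bounds (decode (point n i)).
set x := decode _; rewrite decodeK /point.
have n0 : 0 < 2 ^ n by rewrite expn_gt0.
move=> lb ub; apply/eqP; rewrite eqn_leq -ltnS -(ltn_exp2l _ _ (ltnSn 1)) -ltnS.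
rewrite -[_ <= size x]ltnS -[X in _ && X](ltn_exp2l _ _ (ltnSn 1)) expnS.
by rewrite expnS in ub *; lia.
Qed.

Lemma C_min (U : universal_machine) p x : outputs U p x -> C U x <= size p.
Proof.
move=> Ux; rewrite /C; case: ex_minnP => m _; apply.
by apply/asboolP; exists p.
Qed.

Lemma C_program (U : universal_machine) x :
  exists2 p, outputs U p x & size p = C U x.
Proof. by rewrite /C; case: ex_minnP => m /asboolP. Qed.

Lemma C_le_machine (U : universal_machine) (M : recfun 1) :
  exists d, forall p x, outputs M p x -> C U x <= size p + d.
Proof.
have [d Hd] := machine_universal U M; exists d => p x /Hd[q /C_min].
exact: leq_trans.
Qed.

Lemma outputs_functional M p x y : outputs M p x -> outputs M p y -> x = y.
Proof. by move=> Mx My; apply/code_inj/(eval_functional Mx My). Qed.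

(* Strings of length [G - e] have programs of length less than [G], and these
   programs are not available for strings of length [n >= G]. *)
Lemma many_high (U : universal_machine) : exists e, forall n G, e <= G -> G <= n ->
  2 ^ G <= 2 ^ e * count (fun i => G <= C U (decode (point n i))) (iota 0 (2 ^ G)).
Proof.
(* [Proj ord0] is the identity machine, whence [C U x <= size x + d]; for strings of length
   [G - d.+1] this is below [G]. *)
have [d Hd] := C_le_machine U (Proj ord0).
exists d.+1 => n G leG len.
have /choice[prog Hprog] : forall x, exists p, outputs U p x /\ size p = C U x.
  by move=> x; have [p] := C_program U x; exists p.
pose low := [seq decode (point n i) |
  i <- iota 0 (2 ^ G) & ~~ (G <= C U (decode (point n i)))].
pose short := [seq decode (point (G - d.+1) i) | i <- iota 0 (2 ^ (G - d.+1))].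
have pt_inj m : injective (fun i => decode (point m i)).
  by move=> i j /decode_inj /addnI.
have le_pow m : m <= G -> 2 ^ m <= 2 ^ G by move=> ?; rewrite leq_exp2l.
have Hlow x : x \in low -> size x = n /\ C U x < G.
  case/mapP => i; rewrite mem_filter mem_iota -ltnNge => /andP[lt_C /= lt_i] ->.
  by rewrite size_point //; apply: leq_trans lt_i _; rewrite leq_exp2l.
have Hshort x : x \in short -> size x = G - d.+1 /\ C U x < G.
  case/mapP => i; rewrite mem_iota => /= lt_i ->; rewrite size_point //; split=> //.
  have := Hd (decode (point (G - d.+1) i)) (decode (point (G - d.+1) i)) erefl.
  by rewrite size_point //; lia.
(* The strings of [low] and [short] differ in length, as [G - d.+1 < G <= n], and a program
   determines its output, so the chosen programs are distinct. *)
have uls : uniq [seq code (prog x) | x <- low ++ short].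
  rewrite map_inj_uniq.
    rewrite cat_uniq !map_inj_uniq ?filter_uniq ?iota_uniq //= andbT.
    apply/hasPn => x /Hshort[sx _]; apply/negP => /Hlow[sx' _]; lia.
  move=> x y /code_inj E; apply: (outputs_functional (proj1 (Hprog x))).
  by rewrite E; apply: (proj1 (Hprog y)).
(* There are [(2 ^ G).-1] programs of length less than [G]. *)
have : size [seq code (prog x) | x <- low ++ short] <= size (iota 0 (2 ^ G).-1).
  apply: uniq_leq_size uls _ => _ /mapP[x xls ->].
  have Cx : C U x < G by move: xls; rewrite mem_cat => /orP[/Hlow[]|/Hshort[]].
  have /andP[_] := code_size_bounds (prog x); rewrite (proj2 (Hprog x)) mem_iota /=.
  by have := le_pow _ Cx; lia.
rewrite size_map size_cat !size_map size_filter !size_iota.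
have := count_predC (fun i => G <= C U (decode (point n i))) (iota 0 (2 ^ G)).
rewrite size_iota -[count (predC _) _]/(count (fun i => ~~ (G <= C U (decode
  (point n i)))) _).
have EG : 2 ^ G = 2 ^ d.+1 * 2 ^ (G - d.+1) by rewrite -expnD subnKC.
set u := count _ _; set v := count _ _ => Euv le_vs.
have : 2 ^ (G - d.+1) <= u by lia.
by rewrite EG leq_pmul2l // expn_gt0.
Qed.

(** * Nets *)

Definition bit h i := digit 2 h i == 1.

Lemma digit2E h i : digit 2 h i = bit h i.
Proof.
by rewrite /bit; have := @digit_lt 2 h i isT; case: (digit _ _ _) => [|[]].
Qed.

(* A subset of [N] points is coded by the binary digits of [h], a k-tuple of
   points and a net by the base-[N] digits of [t] and [s]. *)
Definition consistent k (lab : 'I_k -> seq nat -> bool) n N h :=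
  all (fun t => has (fun j : 'I_k => bit h (digit N t j)
        == lab j [seq point n (digit N t i) | i : 'I_k <- enum 'I_k])
      (enum 'I_k)) (iota 0 (N ^ k)).

(** All quantifiers are bounded, so that a net can be found by search; the density condition is the
    one [many_high] provides. *)
Definition is_net k (lab : 'I_k -> seq nat -> bool) e n N T s :=
  all (fun h => ~~ ((N <= 2 ^ e * \sum_(i < N) bit h i) && consistent lab n N h)
        || has (fun r => bit h (digit N s r)) (iota 0 T)) (iota 0 (2 ^ N)).

Lemma sum_bit h N : \sum_(i < N) bit h i = count (bit h) (iota 0 N).
Proof.
elim: N => [|N IHN]; first by rewrite big_ord0.
by rewrite big_ord_recr -[in RHS](addn1 N) iotaD count_cat /= IHN addn0.
Qed.

(** Consistency means that no k-tuple of points shows the complement of its labels; this complement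
    is the pattern forbidden in [sauer_shelah]. *)
Lemma count_consistent k (lab : 'I_k -> seq nat -> bool) n N (F : seq nat) :
  uniq F -> {subset F <= iota 0 (2 ^ N)} -> all (consistent lab n N) F ->
  size F <= N.+1 ^ k.
Proof.
move=> uF sF /allP cF.
(* [sauer_shelah] wants a pattern of the right length on every list; outside length [k] its value is
   a dummy. *)
pose flip (I : seq nat) := if size I == k
  then [seq ~~ lab j [seq point n i | i <- I] | j <- enum 'I_k]
  else nseq (size I) false.
have := @sauer_shelah _ k flip (iota 0 N)
  [seq [seq bit h i | i <- iota 0 N] | h <- F].
rewrite size_map size_iota; apply.
- rewrite map_inj_in_uniq // => h h' /sF hF /sF h'F E.
  move: hF h'F; rewrite !mem_iota => /= hF h'F;
    apply: (digits_inj hF h'F) => i lt_i.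
  have := congr1 (nth false ^~ i) E;
    rewrite /= !(nth_map 0) ?size_iota // !nth_iota // !digit2E.
  by move->.
- by move=> _ /mapP[h _ ->]; rewrite size_map size_iota.
- move=> I; rewrite /flip; case: eqP => [->|_]; last by rewrite size_nseq.
  by rewrite size_map size_enum_ord.
move=> _ m /mapP[h Fh ->] sm sI; rewrite -map_mask.
set I := mask m (iota 0 N) in sI * => E.
(* The base-[N] digits of [t] are the elements of [I]; consistency at [t] contradicts the
   complemented pattern. *)
have [i lt_i|t lt_t dt] := @ex_digits N k (nth 0 I).
  have : nth 0 I i \in I by rewrite mem_nth ?sI.
  by move/mem_mask; rewrite mem_iota.
have := cF h Fh; move/allP/(_ t); rewrite mem_iota /= => /(_ lt_t)/hasP[j _].
have -> : [seq point n (digit N t i) | i : 'I_k <- enum 'I_k] =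
          [seq point n i | i <- I].
  apply: (@eq_from_nth _ 0) => [|i]; rewrite size_map size_enum_ord.
    by rewrite size_map sI.
  move=> lt_i.
  by rewrite (nth_map (Ordinal lt_i)) ?size_enum_ord // nth_enum_ord //
    (nth_map 0) ?sI // dt.
have := congr1 (nth false ^~ j) E; rewrite /flip sI eqxx /=.
rewrite (nth_map 0) ?sI // (nth_map j) ?size_enum_ord // nth_ord_enum dt // => ->.
by case: (lab _ _).
Qed.

(** At most [2 ^ (G.+1 * k)] subsets are consistent, which is less than [2 ^ t]. By [halving], each
    block of [2 ^ e] greedy choices halves the bound on the unhit ones, so [T = 2 ^ e * t] choices
    suffice. *)
Lemma net_exists k (lab : 'I_k -> seq nat -> bool) e n G :
  exists s, is_net lab e n (2 ^ G) (2 ^ e * (G.+1 * k).+1) s.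
Proof.
set N := 2 ^ G; set t := (G.+1 * k).+1; set T := 2 ^ e * t.
have N0 : 0 < N by rewrite expn_gt0.
pose F := [seq h <- iota 0 (2 ^ N) |
  (N <= 2 ^ e * \sum_(i < N) bit h i) && consistent lab n N h].
have Ee : 2 ^ e = (2 ^ e).-1.+1 by rewrite prednK // expn_gt0.
have leF : size F <= 2 ^ (G.+1 * k).
  apply: (@leq_trans (N.+1 ^ k)).
    apply: (@count_consistent k lab n N).
    - by rewrite filter_uniq ?iota_uniq.
    - by move=> h; rewrite mem_filter => /andP[].
    - by apply/allP => h; rewrite mem_filter => /andP[/andP[]].
  rewrite expnM; case: (k) => // k'; rewrite leq_exp2r // expnS -/N; lia.
have [|h|| S [sS SL SF]] := @greedy_hitting _ _ bit (iota 0 N) (2 ^ e).-1 T F.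
- by rewrite size_iota.
- by rewrite mem_filter size_iota -Ee sum_bit => /andP[/andP[]].
- rewrite -Ee; have := halving (2 ^ e).-1 t; rewrite -Ee -/T.
  (* For [e = 0] this power vanishes and cannot be cancelled from the strict inequality. *)
  have [->|p0] := posnP ((2 ^ e).-1 ^ T); first by rewrite !muln0 !expn_gt0.
  apply: leq_trans; rewrite ltn_pmul2r // /t expnS mul2n -addnn.
  by apply: leq_ltn_trans leF _; rewrite -[X in X < _]addn0 ltn_add2l expn_gt0.
have [r lt_r|s _ ds] := @ex_digits N T (nth 0 S).
  have : nth 0 S r \in iota 0 N by apply/SL/mem_nth; rewrite sS.
  by rewrite mem_iota.
exists s; apply/allP => h hN; rewrite -implybE; apply/implyP => Ph.
have /hasP[i iS hi] : has (bit h) S by apply: SF; rewrite mem_filter Ph.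
have [r lt_r Er] := nthP 0 iS; apply/hasP; exists r; first by rewrite mem_iota -sS.
by rewrite ds -?sS // Er.
Qed.

(** * Computability of the net search *)

Lemma recursive_bit n a b : recursive n a -> recursive n b ->
  recursive n (fun s => bit (a s) (b s)).
Proof.
by move=> Ra Rb; apply: recursive_eq; [apply: recursive_digit => //|];
  apply: recursive_const.
Qed.

Lemma recursive_point n a b : recursive n a -> recursive n b ->
  recursive n (fun s => point (a s) (b s)).
Proof.
move=> Ra Rb; apply: recursive_add => //; apply: recursive_pred;
  apply: recursive_exp => //.
exact: recursive_const.
Qed.

Lemma recursive_consistent k (lab : 'I_k -> seq nat -> bool) p a b c :
  (forall j, recursive k (lab j)) -> recursive p a -> recursive p b ->
    recursive p c ->
  recursive p (fun s => consistent lab (a s) (b s) (c s)).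
Proof.
move=> Rlab Ra Rb Rc.
have Rdig j : recursive p.+1 (fun s => digit (b (behead s)) (head 0 s) j).
  by apply: recursive_digit;
    [exact: recursive_behead|exact: recursive_head|exact: recursive_const].
apply: (recursive_forall (P := fun t s => has (fun j : 'I_k => bit (c s)
  (digit (b s) t j)
  == lab j [seq point (a s) (digit (b s) t i) |
    i : 'I_k <- enum 'I_k]) (enum 'I_k))).
  by apply: recursive_exp => //; apply: recursive_const.
apply: (recursive_has (P := fun (j : 'I_k) s => bit (c (behead s))
  (digit (b (behead s)) (head 0 s) j)
  == lab j [seq point (a (behead s)) (digit (b (behead s)) (head 0 s) i) |
    i : 'I_k <- enum 'I_k])) => j.
(* The booleans are compared as the numbers 0 and 1, so that [recursive_eq] applies. *)
apply: (@recursive_ext _ (fun s => (bit (c (behead s)) (digit (b (behead s))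
  (head 0 s) j) : nat)
  == lab j [seq point (a (behead s)) (digit (b (behead s)) (head 0 s) i) |
    i : 'I_k <- enum 'I_k])) => [v|].
  by case: bit; case: (lab _ _).
apply: recursive_eq; first by apply: recursive_bit => //; apply: recursive_behead.
apply: (@recursive_comp k _ (lab j) (fun i s => point (a (behead s))
  (digit (b (behead s)) (head 0 s) i))) => // i.
by apply: recursive_point => //; apply: recursive_behead.
Qed.

Lemma recursive_is_net k (lab : 'I_k -> seq nat -> bool) e p a b c d :
  (forall j, recursive k (lab j)) -> recursive p a -> recursive p b ->
    recursive p c -> recursive p d ->
  recursive p (fun s => is_net lab e (a s) (b s) (c s) (d s)).
Proof.
move=> Rlab Ra Rb Rc Rd.
have Rb' := recursive_behead Rb.
apply: (recursive_forall (P := fun h s =>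
  ~~ ((b s <= 2 ^ e * \sum_(i < b s) bit h i) && consistent lab (a s) (b s) h)
  || has (fun r => bit h (digit (b s) (d s) r)) (iota 0 (c s)))).
  by apply: recursive_exp => //; apply: recursive_const.
apply: recursive_or.
  apply/recursive_neg/recursive_and.
    apply: recursive_leq => //; apply: recursive_mul; first exact: recursive_const.
    apply: (recursive_sum (F := fun i s => bit (head 0 s) i)) => //.
    by apply: recursive_bit;
      [exact: recursive_behead (recursive_head p)|exact: recursive_head].
  by apply: recursive_consistent => //;
    [exact: recursive_behead|exact: recursive_head].
apply: (recursive_exists (P := fun r s => bit (head 0 s) (digit (b (behead s))
  (d (behead s)) r))).
  exact: recursive_behead.
apply: recursive_bit; first exact: recursive_behead (recursive_head p).
by apply: recursive_digit;
  [exact: recursive_behead2|exact: recursive_behead2|exact: recursive_head].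
Qed.

Lemma recursive_computable n (g : nat -> nat) a :
  computable g -> recursive n a -> recursive n (fun s => g (a s)).
Proof.
move=> [e He]; apply: recursive_call1; exists e => v.
have -> : v = [tuple head 0 v] by apply: val_inj; case/tupleP: v => x v;
  rewrite tuple0.
exact: He.
Qed.

(** No computability of [decode] is involved: the labelling is computed from codes, and [decodeK]
    cancels the decoding. *)
Lemma recursive_labelling k (f : k.-tuple string -> k.-tuple bool) (j : 'I_k) :
  computable_labelling f ->
  recursive k (fun s => tnth (f [tuple decode (nth 0 s i) | i < k]) j).
Proof.
move=> [e He]; exists (e j) => v.
have {1}-> : v = map_tuple code [tuple decode (nth 0 v i) | i < k].
  by apply: eq_from_tnth => i; rewrite tnth_map tnth_mktuple decodeK (tnth_nth 0).
exact: He.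
Qed.

(** * A string of HIGH with a short description *)

Lemma quadratic_lt_exp2 c : exists G0, forall G, G0 <= G -> c * G.+1 ^ 2 < 2 ^ G.
Proof.
(* For such [G], [8 * c * G.+1 ^ 2 < G.+1 ^ 3 <= 8 * 2 ^ G]. *)
exists (8 * c) => G leG; rewrite -(ltn_pmul2l (isT : 0 < 8)).
apply: leq_trans (cube_le_exp2 G); rewrite mulnA expnS ltn_pmul2r ?expn_gt0 //.
Qed.

Lemma HIGH_not_one_k_recursive (U : universal_machine) (g : nat -> nat) k :
  computable g -> (forall m, exists n, m <= g n <= n) ->
  ~ one_k_recursive k (HIGH U g).
Proof.
move=> g_comp g_unb [f f_comp f_agrees].
have [e He] := many_high U.
pose lab (j : 'I_k) s := tnth (f [tuple decode (nth 0 s i) | i < k]) j.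
have Rlab j : recursive k (lab j) by apply: recursive_labelling.
have ex_root z : exists y, z < y.+1 ^ 2 by exists z; lia.
(* On input [(m + r) ^ 2 + m], with integer square root [m + r], the machine [W]
   outputs the [r]-th element of the net for the length determined by [m]. *)
pose root z := ex_minn (ex_root z).
pose m z := z - root z ^ 2.
pose len z := ex_minn (g_unb (m z)).
pose T G := 2 ^ e * (G.+1 * k).+1.
have ex_net n : exists s, is_net lab e n (2 ^ g n) (T (g n)) s.
  exact: net_exists.
pose net n := ex_minn (ex_net n).
pose W z := point (len z) (digit (2 ^ g (len z)) (net (len z)) (root z - m z)).
have Rroot : recursive 1 (fun s => root (head 0 s)).
  apply: (recursive_mu (P := fun y s => head 0 s < y.+1 ^ 2)).
  apply/recursive_neg/recursive_leq;
    first exact/recursive_succ/recursive_behead/recursive_head.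
  by apply: recursive_exp; [exact/recursive_succ/recursive_head|exact: recursive_const].
have Rm : recursive 1 (fun s => m (head 0 s)).
  apply: recursive_sub; first exact: recursive_head.
  by apply: recursive_exp => //; apply: recursive_const.
have Rlen : recursive 1 (fun s => len (head 0 s)).
  apply: (recursive_mu (P := fun y s => m (head 0 s) <= g y <= y)).
  have Rg : recursive 2 (fun s => g (head 0 s)).
    by apply: (recursive_computable g_comp); apply: recursive_head.
  apply/recursive_neg/recursive_and; apply: recursive_leq => //;
    last exact: recursive_head.
  exact: (recursive_behead Rm).
have Rg : recursive 1 (fun s => g (len (head 0 s))) by apply: recursive_computable.
have RN : recursive 1 (fun s => 2 ^ g (len (head 0 s))).
  by apply: recursive_exp => //; apply: recursive_const.
have Rnet : recursive 1 (fun s => net (len (head 0 s))).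
  apply: (recursive_mu (P := fun y s => is_net lab e (len (head 0 s))
    (2 ^ g (len (head 0 s))) (T (g (len (head 0 s)))) y)).
  apply/recursive_neg/recursive_is_net => //; last exact: recursive_head.
  - exact: (recursive_behead Rlen).
  - exact: (recursive_behead RN).
  apply: recursive_mul; first exact: recursive_const.
  apply/recursive_succ/recursive_mul; last exact: recursive_const.
  exact/recursive_succ/(recursive_behead Rg).
have [M HM] : recursive 1 (fun s => W (head 0 s)).
  by apply: recursive_point => //; apply: recursive_digit => //;
    apply: recursive_sub.
have [d Hd] := C_le_machine U M.
(* Chosen so that [m0 + r + 1 <= a * G.+1] for every net index [r]; then the input satisfies
   [z.+1 <= (a ^ 2).+1 * G.+1 ^ 2]. *)
pose a := (2 ^ e * k.+1).+1.
have [G0 HG0] := quadratic_lt_exp2 (2 ^ d * (a ^ 2).+1).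
(* Since [m0 <= G], this makes [G] large enough both for [many_high] and for the growth estimate. *)
pose m0 := maxn e G0.
pose n := ex_minn (g_unb m0); pose G := g n.
have [leG len_n] : m0 <= G /\ G <= n by rewrite /G /n; case: ex_minnP => ? /andP[].
have [high [Hhigh1 Hhigh2]] : exists h, h < 2 ^ (2 ^ G) /\
    forall i, i < 2 ^ G -> bit h i = (G <= C U (decode (point n i))).
  have [i _|h lt_h dh] := @ex_digits 2 (2 ^ G)
    (fun i => (G <= C U (decode (point n i))) : nat).
    exact: (leq_b1 (_ <= _)).
  by exists h; split=> // i /dh; rewrite digit2E; case: bit; case: (_ <= _).
have size_pt i : i < 2 ^ G -> size (decode (point n i)) = n.
  by move=> lt_i; apply: size_point; apply: leq_trans lt_i _; rewrite leq_exp2l.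
have high_consistent : consistent lab n (2 ^ G) high.
  (* Consistency at [t] is the agreement of [f] with HIGH on the k-tuple of strings coded by [t]. *)
  apply/allP => t _ /=.
  pose I := [seq point n (digit (2 ^ G) t i) | i : 'I_k <- enum 'I_k].
  have [j] := f_agrees [tuple decode (nth 0 I i) | i < k].
  rewrite tnth_mktuple => Hj; apply/hasP; exists j; first by rewrite mem_enum.
  rewrite -[lab j _]Hj.
  have Ij : nth 0 I j = point n (digit (2 ^ G) t j).
    by rewrite (nth_map j) ?size_enum_ord // nth_ord_enum.
  rewrite Hhigh2 ?digit_lt ?expn_gt0 // Ij.
  by rewrite /HIGH unfold_in size_pt // digit_lt ?expn_gt0.
have high_dense : 2 ^ G <= 2 ^ e * \sum_(i < 2 ^ G) bit high i.
  have eG : e <= G by apply: leq_trans leG; apply: leq_maxl.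
  rewrite sum_bit; apply: leq_trans (He n G eG len_n) _.
  rewrite leq_mul //; apply/eq_leq/eq_in_count => i; rewrite mem_iota => /= lt_i.
  by rewrite Hhigh2.
(* The input lies below [(m0 + r + 1) ^ 2] because [m0 <= m0 + r]. *)
have Dm r : m ((m0 + r) ^ 2 + m0) = m0 /\ root ((m0 + r) ^ 2 + m0) = m0 + r.
  suff Er : root ((m0 + r) ^ 2 + m0) = m0 + r by rewrite /m Er addKn.
  rewrite /root; case: ex_minnP => y lt_y min_y; apply/eqP;
    rewrite eqn_leq min_y; last by lia.
  by rewrite leqNgt; apply/negP => lt_yr; nia.
have netP : is_net lab e n (2 ^ G) (T G) (net n).
  by rewrite /net; case: ex_minnP.
have len_m0 z : m z = m0 -> len z = n by rewrite /len => ->.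
have [z [r [Ez lt_r Wz]]] : exists z r, [/\ z = (m0 + r) ^ 2 + m0, r < T G &
    G <= C U (decode (W z))].
  have := netP; move/allP/(_ high);
    rewrite mem_iota high_dense high_consistent => /(_ Hhigh1)/hasP[r].
  rewrite mem_iota => /= lt_r Hr; exists ((m0 + r) ^ 2 + m0), r; split=> //.
  have [mz rz] := Dm r; rewrite /W rz mz addKn (len_m0 _ mz) -/G -Hhigh2 // digit_lt //.
  by rewrite expn_gt0.
have Mz : outputs M (decode z) (decode (W z)).
  by have := HM [tuple z]; rewrite /outputs !decodeK.
have := Hd _ _ Mz; have /andP[lb _] := code_size_bounds (decode z).
rewrite decodeK in lb.
move: (size _) lb => l lb leC.
(* This combines [G <= l + d] with [2 ^ l <= z.+1]; it is contradictory because [z] is at most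
   quadratic in [G]. *)
have {leC} : 2 ^ G <= 2 ^ d * z.+1.
  apply: (@leq_trans (2 ^ (d + l))); first by rewrite leq_exp2l //; lia.
  by rewrite expnD leq_mul2l lb orbT.
have := HG0 G (leq_trans (leq_maxr _ _) leG).
suff : z.+1 <= (a ^ 2).+1 * G.+1 ^ 2.
  move: (2 ^ d) (2 ^ G) => D Q le_z; rewrite -mulnA => lt1 le1.
  have := leq_mul (leqnn D) le_z; lia.
have le_m0 : m0 <= G := leG.
have e0 : 0 < 2 ^ e by rewrite expn_gt0.
move: Ez lt_r; rewrite /T /a; move: (2 ^ e) e0 => E e0 -> lt_r {lb}.
have le_r : m0 + r + 1 <= (E * k.+1).+1 * G.+1 by nia.
suff : ((m0 + r) ^ 2 + m0).+1 <= (m0 + r + 1) ^ 2 + G.+1 ^ 2.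
  move/leq_trans; apply; rewrite mulSn addnC leq_add2l -expnMn leq_exp2r //.
by rewrite !expnS !expn0; nia.
Qed.

(* The literal reading, with n - g(n) an integer that may be negative and the
   two quantities unbounded independently, is refuted by g(n) = 0 for n even
   and g(n) = 2n for n odd, for which HIGH_g is computable. The values
   considered are therefore those at lengths n with g(n) <= n. For (ii),
   truncated subtraction gives the same set because C is nonnegative. *)
Theorem theorem3p1 (U : universal_machine) (g : nat -> nat) (c : nat)
    (g_comp : computable g)
    (g_unbounded : forall m, exists n, g n <= n /\ m <= g n)
    (ng_unbounded : forall m, exists n, g n <= n /\ m <= n - g n)
    (k : nat) (k_gt0 : 0 < k) :
  ~ one_k_recursive k (HIGH U g) /\
  ~ one_k_recursive k (HIGH U (fun n => n - c)).
Proof.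
split; apply: HIGH_not_one_k_recursive => //.
- by move=> m; have [n [le_n le_m]] := g_unbounded m; exists n; rewrite le_m.
- have [e He] : recursive 1 (fun s => head 0 s - c).
    by apply: recursive_sub; [exact: recursive_head | exact: recursive_const].
  by exists e => n; apply: (He [tuple n]).
- by move=> m; exists (m + c); rewrite addnK leqnn leq_addr.
Qed.
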